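(* Let $d\geq 3$ be an integer, $p\geq 1$, and let $g$ be a probability density on $(0,1)^d$ which is differentiable, bounded from above, bounded from below by a positive constant, and has bounded gradient. For measurable $f\geq 0$ on $(0,1)^d$ with $\int f=1$, set $$J_g(f)=\int_{(0,1)^d} g(x)f(x)^{-p/d}\,dx\in(0,\infty].$$ Then the problem of minimizing $J_g(f)$ over all $f\geq 0$ with $\int f=1$ is solved by $$f^*(x)=\frac{1}{\int g^{\frac{d}{p+d}}}\,g(x)^{\frac{d}{p+d}},$$ and the minimum value is $$J_g(f^* )=\left(\int_{(0,1)^d} g^{\frac{d}{p+d}}\right)^{\frac{p+d}{d}}.$$
   Context: All integrals are over $(0,1)^d$ with respect to Lebesgue measure. By convention $f(x)^{-p/d}=+\infty$ where $f(x)=0$. *)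

(* Defs.v *)
From HB Require Import structures.
From mathcomp Require Import all_boot all_order all_algebra.
From mathcomp Require Import all_classical all_reals all_analysis.

Set Implicit Arguments.
Unset Strict Implicit.
Unset Printing Implicit Defensive.

Import Order.TTheory GRing.Theory Num.Theory.
Import numFieldNormedType.Exports.

Local Open Scope classical_set_scope.
Local Open Scope ring_scope.

Definition rV_display : measure_display -> measure_display.
Proof. exact. Qed.

(* Product (equivalently, Borel) sigma-algebra of R^n. MathComp-Analysis has it
   on n.-tuple R only, whereas differentials need the normed space 'rV[R]_n. *)
Section borel_rV.
Context (R : realType) (n : nat).

Let coor (i : 'I_n) (x : 'rV[R]_n) : R := x ord0 i.

Let rV_set0 : g_sigma_preimage coor set0.
Proof. exact: sigma_algebra0. Qed.

Let rV_setC A : g_sigma_preimage coor A -> g_sigma_preimage coor (~` A).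
Proof. exact: sigma_algebraC. Qed.

Let rV_bigcup (F : _^nat) : (forall i, g_sigma_preimage coor (F i)) ->
  g_sigma_preimage coor (\bigcup_i (F i)).
Proof. exact: sigma_algebra_bigcup. Qed.

HB.instance Definition _ := @isMeasurable.Build
  (rV_display default_measure_display) 'rV[R]_n (g_sigma_preimage coor)
  rV_set0 rV_setC rV_bigcup.

Lemma measurable_rV_coor (i : 'I_n) :
  measurable_fun [set: 'rV[R]_n] (fun x : 'rV[R]_n => x ord0 i : R).
Proof.
move=> _ Y mY; rewrite setTI; apply: sub_sigma_algebra => /=.
rewrite -bigcup_seq/=; exists i => /=; first by rewrite mem_index_enum.
by exists Y => //; rewrite setTI.
Qed.

Lemma measurable_fun_rV d (T : measurableType d) (f : T -> 'rV[R]_n) :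
  (forall i, measurable_fun [set: T] (fun t => f t ord0 i : R)) ->
  measurable_fun [set: T] f.
Proof.
move=> mf _ A mA; rewrite setTI.
have : <<s [set B | measurable (f @^-1` B)] >> A.
  move: A mA; apply: sub_smallest2r.
  - exact: smallest_sigma_algebra.
  - rewrite -bigcup_seq => B [i _] [C mC] <-; rewrite /= setTI.
    by have := mf i measurableT _ mC; rewrite setTI.
rewrite sigma_algebra_id//; split => //=.
- by rewrite preimage_set0.
- by move=> B mB; rewrite setTD preimage_setC; exact: measurableC.
- by move=> F mF; rewrite preimage_bigcup; exact: bigcup_measurable.
Qed.

End borel_rV.

Section lebesgue_rV.
Context (R : realType).

Definition rV_cons n (p : measurableTypeR R * 'rV[R]_n) : 'rV[R]_n.+1 :=
  \row_i (if unlift ord0 i is Some j then p.2 ord0 j else p.1).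

Definition rV_uncons n (x : 'rV[R]_n.+1) : measurableTypeR R * 'rV[R]_n :=
  (x ord0 ord0, \row_j x ord0 (lift ord0 j)).

Lemma rV_consK n : cancel (@rV_cons n) (@rV_uncons n).
Proof.
move=> [r x]; rewrite /rV_uncons/= mxE unlift_none; congr pair.
by apply/rowP => j; rewrite !mxE liftK.
Qed.

Lemma measurable_rV_cons n : measurable_fun setT (@rV_cons n).
Proof.
apply: measurable_fun_rV => i; rewrite /rV_cons.
under eq_fun do rewrite mxE.
case: unliftP => [j _|_]; last exact: measurable_fst.
apply: (measurableT_comp (@measurable_rV_coor R n j)).
exact: measurable_snd.
Qed.

Lemma measurable_rV_uncons n : measurable_fun setT (@rV_uncons n).
Proof.
apply: (measurable_fun_pair (T2 := 'rV[R]_n)); first exact: measurable_rV_coor.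
apply: measurable_fun_rV => i; under eq_fun do rewrite mxE.
exact: measurable_rV_coor.
Qed.

Definition rV_cons_measure n (m : {sigma_finite_measure set 'rV[R]_n -> \bar R})
    : set 'rV[R]_n.+1 -> \bar R :=
  pushforward (lebesgue_measure \x m)%E (@rV_cons n).

Section rV_cons_measure.
Context n (m : {sigma_finite_measure set 'rV[R]_n -> \bar R}).

Let rV_cons_measure0 : rV_cons_measure m set0 = 0%E.
Proof. by rewrite /rV_cons_measure /pushforward preimage_set0 measure0. Qed.

Let rV_cons_measure_ge0 A : (0 <= rV_cons_measure m A)%E.
Proof. by rewrite /rV_cons_measure /pushforward measure_ge0. Qed.

Let mcons (A : set 'rV[R]_n.+1) :
  measurable A -> measurable (@rV_cons n @^-1` A).
Proof.
by move=> mA; rewrite -[X in measurable X]setTI; exact: measurable_rV_cons.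
Qed.

Let rV_cons_measure_sigma_additive : semi_sigma_additive (rV_cons_measure m).
Proof.
move=> F mF tF mUF; rewrite /rV_cons_measure /pushforward preimage_bigcup.
apply: measure_semi_sigma_additive => //=.
- by move=> k; exact: mcons.
- apply/trivIsetP => /= i j _ _ ij; rewrite -preimage_setI.
  by move/trivIsetP : tF => /(_ _ _ _ _ ij) ->//; rewrite preimage_set0.
- by rewrite -preimage_bigcup; exact: mcons.
Qed.

HB.instance Definition _ := isMeasure.Build _ _ _ (rV_cons_measure m)
  rV_cons_measure0 rV_cons_measure_ge0 rV_cons_measure_sigma_additive.

Let rV_cons_measure_sigma_finite : sigma_finite setT (rV_cons_measure m).
Proof.
have /sigma_finiteP[F [TF ndF Foo]] := sigma_finiteT (@lebesgue_measure R).
have /sigma_finiteP[G [TG ndG Goo]] := sigma_finiteT m.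
exists (fun k => @rV_uncons n @^-1` (F k `*` G k)).
  rewrite -preimage_bigcup (_ : \bigcup_k _ = setT) ?preimage_setT//.
  rewrite -subTset -setXTT TF TG => -[r x] /= [[i _ Fir] [j _ Gjx]].
  exists (maxn i j) => //; split => /=.
    by move: r Fir; exact/subsetPset/ndF/leq_maxl.
  by move: x Gjx; exact/subsetPset/ndG/leq_maxr.
move=> k; have [mF Fkoo] := Foo k; have [mG Gkoo] := Goo k; split.
  rewrite -[X in measurable X]setTI; apply: measurable_rV_uncons => //.
  exact: measurableX.
rewrite /rV_cons_measure /pushforward -comp_preimage.
rewrite (_ : _ \o _ = id); last by rewrite funeqE => p /=; rewrite rV_consK.
by rewrite preimage_id product_measure1E// lte_mul_pinfty// ge0_fin_numE.
Qed.

HB.instance Definition _ := Measure_isSigmaFinite.Build _ _ _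
  (rV_cons_measure m) rV_cons_measure_sigma_finite.

End rV_cons_measure.

(* Lebesgue measure on the Borel sets of R^n, as the n-fold product of the
   one-dimensional one; \d_0 is the unit mass on the single point of R^0. *)
Fixpoint borel_lebesgue_rV n : {sigma_finite_measure set 'rV[R]_n -> \bar R} :=
  if n is n'.+1 then rV_cons_measure (borel_lebesgue_rV n')
  else \d_(0 : 'rV[R]_0).

Let box n (A : 'I_n -> set R) : set 'rV[R]_n :=
  [set x | forall i, A i (x ord0 i)].

Let measurable_box n (A : 'I_n -> set R) :
  (forall i, measurable (A i)) -> measurable (box A).
Proof.
move=> mA; rewrite (_ : box A = \bigcap_(i in [set: 'I_n])
    ((fun x : 'rV[R]_n => x ord0 i : R) @^-1` A i)); last first.
  by rewrite predeqE => x; split => [+ i _|+ i]; apply.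
apply: fin_bigcap_measurable => // i _; rewrite -[X in measurable X]setTI.
exact: measurable_rV_coor.
Qed.

Lemma borel_lebesgue_rV_box n (A : 'I_n -> set R) :
  (forall i, measurable (A i)) ->
  borel_lebesgue_rV n [set x : 'rV[R]_n | forall i, A i (x ord0 i)] =
  (\prod_(i < n) lebesgue_measure (A i))%E.
Proof.
rewrite -/(box A); elim: n A => [|n IHn] A mA.
  by rewrite big_ord0 [LHS]diracE mem_set// => -[].
rewrite big_ord_recl -IHn => [|i]; last exact: mA.
rewrite -product_measure1E; [|exact: mA|by apply: measurable_box => i; exact: mA].
rewrite /= /rV_cons_measure /pushforward; congr (_ _).
rewrite predeqE => -[r x]; split => /= [Ax|[Ar Ax] i].
  split => [|i]; first by have := Ax ord0; rewrite mxE unlift_none.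
  by have := Ax (lift ord0 i); rewrite mxE liftK.
by rewrite mxE; case: unliftP => [j ->|->].
Qed.

(* Completing makes "measurable" mean "Lebesgue measurable", not just Borel. *)
Definition lebesgue_rV_type n : measurableType _ :=
  caratheodory_type (mu_ext (borel_lebesgue_rV n : set 'rV[R]_n -> \bar R)).

Definition lebesgue_rV n : set (lebesgue_rV_type n) -> \bar R :=
  @completed_measure_extension _ _ _ (borel_lebesgue_rV n).

HB.instance Definition _ n := Measure.on (@lebesgue_rV n).

End lebesgue_rV.
Arguments lebesgue_rV_type R n : clear implicits.
Arguments lebesgue_rV R n : clear implicits.

Section problem.
Context (R : realType) (d : nat).

Definition open_cube : set 'rV[R]_d :=
  [set x | forall i, 0 < x ord0 i < 1].

Definition prob_density (f : 'rV[R]_d -> R) : Prop :=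
  [/\ measurable_fun (open_cube : set (lebesgue_rV_type R d))
        (f : lebesgue_rV_type R d -> R),
      forall x, open_cube x -> 0 <= f x &
      (\int[lebesgue_rV R d]_(x in open_cube) (f x)%:E = 1)%E].

Definition gradient (f : 'rV[R]_d -> R) (x : 'rV[R]_d) : 'rV[R]_d :=
  \row_i 'D_(delta_mx ord0 i) f x.

(* The library's norm on 'rV[R]_d is the sup norm. *)
Definition euclidean_norm (v : 'rV[R]_d) : R :=
  Num.sqrt (\sum_i v ord0 i ^+ 2).

(* powR totalizes 0 `^ (- s) to 0 for s != 0, whence the explicit case. *)
Definition inv_power (s t : R) : \bar R :=
  if t == 0 then +oo%E else (t `^ (- s))%:E.

Definition J (p : R) (g f : 'rV[R]_d -> R) : \bar R :=
  (\int[lebesgue_rV R d]_(x in open_cube)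
     ((g x)%:E * inv_power (p / d%:R) (f x)))%E.

End problem.
Arguments open_cube R d : clear implicits.

(* Main.v *)
(** Write [s = p/d] and [lambda = Z `^ (1 + s)].  The function [fstar] satisfies
    the Euler-Lagrange equation [g * fstar `^ (- s) = lambda * fstar], so the
    tangent-line inequality [1 + s <= t `^ (- s) + s * t] at
    [t = f x / fstar x] gives, pointwise,
    [(1 + s) * lambda * fstar <= g * f `^ (- s) + s * lambda * f].
    Both densities have mass 1, so integrating yields [lambda <= J p g f],
    with equality for [f = fstar]. *)
Require Import Defs.
From HB Require Import structures.
From mathcomp Require Import all_boot all_order all_algebra.
From mathcomp Require Import all_classical all_reals all_analysis.
From mathcomp Require Import measurable_realfun ring lra.

Import Order.TTheory GRing.Theory Num.Theory.
Import numFieldNormedType.Exports.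

Local Open Scope classical_set_scope.
Local Open Scope ring_scope.

Lemma powRN_tangent (R : realType) (s t : R) :
  0 <= s -> 0 < t -> 1 + s <= t `^ (- s) + s * t.
Proof.
move=> s0 t0; have ln_le : ln t <= t - 1.
  have := @le_ln1Dx R (t - 1); rewrite (addrC 1) subrK; apply.
  by rewrite ltrBrDr addNr.
have := @expR_ge1Dx R (- s * ln t); rewrite /powR gt_eqF// => h.
have := ler_wpM2l s0 ln_le; nra.
Qed.

(** The tangent inequality at [t / u], multiplied by [lam * u]. The [lam * t] term stays on the
    right, so both sides are nonnegative and the value [+oo] is harmless. *)
Lemma inv_power_tangent (R : realType) (s a lam u t : R) :
  0 <= s -> 0 < a -> 0 < lam -> 0 < u -> 0 <= t ->
  a * u `^ (- s) = lam * u ->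
  (((1 + s) * lam * u)%:E <= a%:E * inv_power s t + (s * lam * t)%:E)%E.
Proof.
move=> s0 a0 lam0 u0 t0 EL; rewrite /inv_power.
(* At [t = 0] the right side is [+oo], because [a] is strictly positive. *)
have [->|tN0] := eqVneq t 0; first by rewrite gt0_muley ?lte_fin// leey.
have {tN0}tp : 0 < t by rewrite lt0r tN0.
rewrite -EFinM -EFinD lee_fin.
have tu0 : 0 < t / u by rewrite divr_gt0.
have -> : a * t `^ (- s) = lam * u * (t / u) `^ (- s).
  by rewrite -EL -mulrA -powRM ?ltW// mulrCA divff ?mulr1// gt_eqF.
have -> : s * lam * t = lam * u * (s * (t / u)).
  by field; rewrite gt_eqF.
rewrite -mulrDr (_ : (1 + s) * lam * u = lam * u * (1 + s)); last by ring.
by rewrite ler_wpM2l ?powRN_tangent// ltW ?mulr_gt0.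
Qed.

Lemma inv_power_ge0 (R : realType) (s t : R) : (0 <= inv_power s t)%E.
Proof. by rewrite /inv_power; case: ifP => // _; rewrite lee_fin powR_ge0. Qed.

Lemma measurable_inv_power (R : realType) (s : R) :
  measurable_fun [set: R] (inv_power s).
Proof.
apply: measurable_fun_ifT => //.
- apply: (measurable_fun_bool true).
  rewrite (_ : _ @^-1` _ = [set 0]) ?setTI//.
  by apply/seteqP; split => [_ /eqP ->//|_ -> /=]; rewrite eqxx.
- by apply/measurable_EFinP; exact: measurable_powR.
Qed.

Section euler_lagrange.
Context {R : realType} {dT : measure_display} {T : measurableType dT}.
Variables (mu : {measure set T -> \bar R}) (D : set T) (g h : T -> R) (s lam : R).
Hypotheses (mD : measurable D) (s0 : 0 <= s) (lam0 : 0 < lam).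
Hypotheses (mg : measurable_fun D g) (g0 : forall x, D x -> 0 < g x).
Hypotheses (mh : measurable_fun D h) (h0 : forall x, D x -> 0 < h x).
Hypothesis h1 : (\int[mu]_(x in D) (h x)%:E = 1)%E.
Hypothesis EL : forall x, D x -> g x * h x `^ (- s) = lam * h x.

(** By [EL] the integrand is [lam * h], and [h] has mass 1. *)
Lemma integral_EulerLagrange_minimizer :
  (\int[mu]_(x in D) ((g x)%:E * inv_power s (h x)) = lam%:E)%E.
Proof.
transitivity (\int[mu]_(x in D) (lam%:E * (h x)%:E))%E.
  apply: eq_integral => x; rewrite inE => Dx.
  by rewrite /inv_power gt_eqF ?h0// -!EFinM EL.
rewrite ge0_integralZl_EFin ?h1 ?mule1 ?ltW//.
- by move=> x Dx; rewrite lee_fin ltW// h0.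
- exact/measurable_EFinP.
Qed.

Lemma le_integral_EulerLagrange (f : T -> R) : measurable_fun D f ->
  (forall x, D x -> 0 <= f x) -> (\int[mu]_(x in D) (f x)%:E = 1)%E ->
  (lam%:E <= \int[mu]_(x in D) ((g x)%:E * inv_power s (f x)))%E.
Proof.
move=> mf f0 f1; have slam0 : 0 <= s * lam by rewrite mulr_ge0// ltW.
have mGf : measurable_fun D (fun x => (g x)%:E * inv_power s (f x))%E.
  apply: emeasurable_funM; first exact/measurable_EFinP.
  exact: (measurableT_comp (@measurable_inv_power R s)).
have mf' : measurable_fun D (fun x => (s * lam * f x)%:E).
  by apply/measurable_EFinP; exact: measurable_funM.
have Gf0 x : D x -> (0 <= (g x)%:E * inv_power s (f x))%E.
  by move=> Dx; rewrite mule_ge0 ?inv_power_ge0// lee_fin ltW// g0.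
(* To be applied to both [h] and [f], the two functions of mass 1. *)
have int_scale k (u : T -> R) : 0 <= k -> measurable_fun D u ->
    (forall x, D x -> 0 <= u x) -> (\int[mu]_(x in D) (u x)%:E = 1)%E ->
    (\int[mu]_(x in D) (k * u x)%:E = k%:E)%E.
  move=> k0 mu' u0 u1; under eq_integral do rewrite EFinM.
  rewrite ge0_integralZl_EFin ?u1 ?mule1//; exact/measurable_EFinP.
have : (\int[mu]_(x in D) ((1 + s) * lam * h x)%:E <=
    \int[mu]_(x in D) ((g x)%:E * inv_power s (f x) + (s * lam * f x)%:E))%E.
  apply: ge0_le_integral => //.
  - by move=> x Dx; rewrite lee_fin !mulr_ge0 ?addr_ge0// ltW// h0.
  - by apply/measurable_EFinP; exact: measurable_funM.
  - exact: emeasurable_funD.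
  - by move=> x Dx; apply: inv_power_tangent; rewrite ?g0 ?h0 ?f0 ?EL.
rewrite ge0_integralD//; last first.
  by move=> x Dx; rewrite lee_fin mulr_ge0// f0.
rewrite !int_scale ?mulr_ge0 ?addr_ge0 ?(ltW lam0)//; last first.
  by move=> x Dx; rewrite ltW// h0.
by rewrite -leeBlDr// -EFinB (_ : _ - _ = lam)//; ring.
Qed.

End euler_lagrange.

Section open_cube.
Context (R : realType) (d : nat).

Let open_cubeE : open_cube R d =
  [set x | forall i : 'I_d, (`]0%R, 1%R[%classic : set R) (x ord0 i)].
Proof. by apply/seteqP; split=> x Dx i; have := Dx i; rewrite /= in_itv. Qed.

Lemma measurable_open_cube : measurable (open_cube R d).
Proof.
rewrite (_ : open_cube R d = \bigcap_(i in [set: 'I_d])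
    ((fun x : 'rV[R]_d => x ord0 i : R) @^-1` `]0%R, 1%R[)); last first.
  by rewrite open_cubeE predeqE => x; split => [+ i _|+ i]; apply.
apply: fin_bigcap_measurable => // i _; rewrite -[X in measurable X]setTI.
exact: measurable_rV_coor.
Qed.

Lemma lebesgue_measurable_open_cube :
  measurable (open_cube R d : set (lebesgue_rV_type R d)).
Proof.
apply: sub_caratheodory; apply: sub_sigma_algebra; exact: measurable_open_cube.
Qed.

(** On Borel sets the completed measure agrees with the product measure, and each side of the cube
    has length 1. *)
Lemma lebesgue_rV_open_cube : lebesgue_rV R d (open_cube R d) = 1%E.
Proof.
rewrite /lebesgue_rV /completed_measure_extension measurable_mu_extE; last first.
  exact: measurable_open_cube.
rewrite open_cubeE.
rewrite [LHS](@borel_lebesgue_rV_box R d (fun=> `]0%R, 1%R[%classic))//.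
by rewrite big1// => i _; rewrite lebesgue_measure_itv/= lte_fin ltr01 oppr0 adde0.
Qed.

End open_cube.

Theorem proposition2p3 (R : realType) (d : nat) (p : R) (g : 'rV[R]_d -> R)
  (hd : (3 <= d)%N) (hp : 1 <= p)
  (g_density : prob_density g)
  (g_diff : forall x, open_cube R d x -> differentiable g x)
  (g_above : exists M : R, forall x, open_cube R d x -> g x <= M)
  (g_below : exists2 m : R, 0 < m & forall x, open_cube R d x -> m <= g x)
  (g_grad : exists M : R, forall x, open_cube R d x ->
     euclidean_norm (gradient g x) <= M) :
  let q : R := d%:R / (p + d%:R) in
  let Z : R := \int[lebesgue_rV R d]_(x in open_cube R d) (g x `^ q) in
  let fstar : 'rV[R]_d -> R := fun x => Z^-1 * g x `^ q in
  [/\ forall f, prob_density f -> (0 < J p g f)%E,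
      prob_density fstar,
      forall f, prob_density f -> (J p g fstar <= J p g f)%E &
      J p g fstar = (Z `^ ((p + d%:R) / d%:R))%:E].
Proof.
move=> q Z fstar.
have [M gM] := g_above; have [m m0 mg] := g_below.
have [meas_g _ _] := g_density.
have d0 : 0 < d%:R :> R by rewrite ltr0n (leq_trans _ hd).
have p0 : 0 < p by rewrite (lt_le_trans ltr01).
have q0 : 0 <= q by rewrite divr_ge0 ?addr_ge0 ?ltW.
have g0 x : open_cube R d x -> 0 < g x by move/mg; exact: lt_le_trans.
have mD := @lebesgue_measurable_open_cube R d.
have meas_gq : measurable_fun (open_cube R d : set (lebesgue_rV_type R d))
    ((fun x => g x `^ q) : lebesgue_rV_type R d -> R).
  exact: (measurableT_comp (@measurable_powR R q)).
have int_cst (c : R) : (lebesgue_rV R d).-integrable (open_cube R d) (EFin \o cst c).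
  apply: measurable_bounded_integrable => //.
    by rewrite [X in (X < _)%E]lebesgue_rV_open_cube ltry.
  by exists `|c|; split; [exact: num_real|move=> y cy x _; exact: ltW].
(* The upper bound on [g] gives the integrable majorant [M]^ q[; below, the lower bound gives]m
   [^ q <= Z]. *)
have int_gq : (lebesgue_rV R d).-integrable (open_cube R d)
    (EFin \o (fun x => g x `^ q)).
  apply: le_integrable (int_cst (M `^ q)) => //; first exact/measurable_EFinP.
  move=> x Dx /=; rewrite lee_fin !ger0_norm ?powR_ge0//.
  have gx0 := ltW (g0 _ Dx).
  by rewrite ge0_ler_powR// ?nnegrE ?gM// (le_trans gx0)// gM.
have Z0 : 0 < Z.
  apply: (@lt_le_trans _ _ (m `^ q)); first by rewrite powR_gt0.
  have <- : (\int[lebesgue_rV R d]_(x in open_cube R d) (m `^ q) = m `^ q)%R.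
    by rewrite Rintegral_cst// [X in fine X]lebesgue_rV_open_cube mulr1.
  apply: le_Rintegral => //; first exact: int_cst.
  move=> x Dx.
  by rewrite ge0_ler_powR ?mg// nnegrE ltW// g0.
have fstar0 x : open_cube R d x -> 0 < fstar x.
  by move=> Dx; rewrite /fstar mulr_gt0 ?invr_gt0// powR_gt0// g0.
have fstar_density : prob_density fstar.
  split; [exact: measurable_funM|by move=> x Dx; rewrite ltW// fstar0|].
  under eq_integral do rewrite /fstar EFinM.
  rewrite (@integralZl _ _ _ (lebesgue_rV R d))//.
  (* [Z] is the [fine] part of the extended integral, so finiteness is needed to identify the
     two. *)
  rewrite -[X in (_ * X)%E]fineK; last exact: (integrable_fin_num mD int_gq).
  by rewrite -EFinM mulVf// gt_eqF.
set lam := Z `^ ((p + d%:R) / d%:R); set s := p / d%:R.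
have s0 : 0 <= s by rewrite divr_ge0 ?ltW.
have lam0 : 0 < lam by rewrite powR_gt0.
(* Since [q = 1 / (1 + s)], the exponents of [g] match by [1 - q * s = q], and those of [Z] by
   [s = (1 + s) - 1]. *)
have EL x : open_cube R d x -> g x * fstar x `^ (- s) = lam * fstar x.
  move=> Dx; have gx0 := g0 _ Dx.
  have ZN1 : Z^-1 = Z `^ (- 1) by rewrite powR_inv1// ltW.
  have dN0 : d%:R != 0 :> R by rewrite gt_eqF.
  have pd0 : p + d%:R != 0 by rewrite gt_eqF// addr_gt0.
  rewrite /fstar powRM ?invr_ge0 ?powR_ge0 ?(ltW Z0)// ZN1 -!powRrM.
  rewrite -{1}[g x]powRr1 ?ltW// mulrCA.
  rewrite -powRD; last by apply/implyP => _; rewrite gt_eqF.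
  rewrite mulrA /lam -powRD; last by apply/implyP => _; rewrite gt_eqF.
  by congr (_ `^ _ * _ `^ _); rewrite /q /s; field; rewrite ?pd0 dN0.
have [meas_fstar _ fstar1] := fstar_density.
have Jstar : J p g fstar = lam%:E.
  exact: (@integral_EulerLagrange_minimizer _ _ _ (lebesgue_rV R d)
    _ _ _ s _ mD lam0 meas_fstar fstar0 fstar1 EL).
have Jge f : prob_density f -> (lam%:E <= J p g f)%E.
  move=> [mf f0 f1].
  exact: (@le_integral_EulerLagrange _ _ _ (lebesgue_rV R d) _ _ _ _ _
    mD s0 lam0 meas_g g0 meas_fstar fstar0 fstar1 EL).
split => //.
(* Strict positivity of [J] comes from the lower bound [lam], itself positive. *)
- by move=> f /Jge; apply: lt_le_trans; rewrite lte_fin.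
- by move=> f /Jge; rewrite Jstar.
Qed.
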